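(* Let $V,W\in\mathbb R^{n\times\hat n}$ be the projection matrices obtained by the Sylvester fixed point iteration (described in the context), given that it converged, and let $\tilde F,\tilde G$ be the mixed covariance functions formed with the resulting reduced matrices. Let $$P(T)=\mathcal T_P\Sigma_P(T)\mathcal T_P^\top,\qquad Q(T)=\mathcal T_Q\Sigma_Q(T)\mathcal T_Q^\top$$ with $\mathcal T_P,\mathcal T_Q$ invertible and $\Sigma_\ell(T)=\operatorname{diag}(\sigma_{\ell,1}(T),\dots,\sigma_{\ell,n}(T))$, $\ell\in\{P,Q\}$, and partition $$\mathcal T_P=\begin{pmatrix}V_P&\mathcal T_{P,2}\end{pmatrix},\quad \mathcal T_Q=\begin{pmatrix}W_Q&\mathcal T_{Q,2}\end{pmatrix},\quad \Sigma_\ell(T)=\begin{pmatrix}\Sigma_{\ell,1}(T)&0\\0&\Sigma_{\ell,2}(T)\end{pmatrix},$$ with $V_P,W_Q\in\mathbb R^{n\times\hat n}$ and $\Sigma_{\ell,2}(T)=\operatorname{diag}(\sigma_{\ell,\hat n+1}(T),\dots,\sigma_{\ell,n}(T))$. Then there exist $M_{\tilde F}(t)\in\mathbb R^{\hat n\times\hat n}$, $M_{\tilde F,2}(t)\in\mathbb R^{(n-\hat n)\times\hat n}$ ($t\in[0,T]$) and $M_{\tilde P}(T)\in\mathbb R^{\hat n\times\hat n}$, $M_{\tilde P,2}(T)\in\mathbb R^{(n-\hat n)\times\hat n}$ such that $$\tilde F(t)=V_PM_{\tilde F}(t)+\mathcal T_{P,2}\Sigma_{P,2}(T)M_{\tilde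 F,2}(t),\qquad V=V_PM_{\tilde P}(T)+\mathcal T_{P,2}\Sigma_{P,2}(T)M_{\tilde P,2}(T).$$ Moreover, there exist $M_{\tilde G}(t)\in\mathbb R^{\hat n\times\hat n}$, $M_{\tilde G,2}(t)\in\mathbb R^{(n-\hat n)\times\hat n}$ ($t\in[0,T]$) and $M_{\tilde Q}(T)\in\mathbb R^{\hat n\times\hat n}$, $M_{\tilde Q,2}(T)\in\mathbb R^{(n-\hat n)\times\hat n}$ such that $$\tilde G(t)=W_QM_{\tilde G}(t)+\mathcal T_{Q,2}\Sigma_{Q,2}(T)M_{\tilde G,2}(t),\qquad W=W_QM_{\tilde Q}(T)+\mathcal T_{Q,2}\Sigma_{Q,2}(T)M_{\tilde Q,2}(T).$$
   Context: Setting. $A,N_1,\dots,N_q\in\mathbb R^{n\times n}$, $X_0\in\mathbb R^{n\times m}$, $C\in\mathbb R^{p\times n}$, $T>0$, and $M$ is an $\mathbb R^q$-valued square integrable mean-zero Lévy process with covariance matrix $K_M=(k_{ij})$, $\mathbb E[M(t)M(t)^\top]=K_Mt$ (symmetric positive semidefinite). Reduced matrices are $\hat A,\hat N_i\in\mathbb R^{\hat n\times\hat n}$, $\hat X_0\in\mathbb R^{\hat n\times m}$, $\hat C\in\mathbb R^{p\times\hat n}$. Operators: $\mathcal L(X)=AX+XA^\top+\sum_{i,j}N_iXN_j^\top k_{ij}$, $\hat{\mathcal L}(X)=\hat AX+X\hat A^\top+\sum_{i,j}\hat N_iX\hat N_j^\top k_{ij}$, $\tilde{\mathcal L}(X)=AX+X\hat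 A^\top+\sum_{i,j}N_iX\hat N_j^\top k_{ij}$, with Frobenius adjoints $\mathcal L^*(X)=A^\top X+XA+\sum_{i,j}N_i^\top XN_jk_{ij}$, $\tilde{\mathcal L}^*(X)=A^\top X+X\hat A+\sum_{i,j}N_i^\top X\hat N_jk_{ij}$. Throughout, $\mathcal L$ and $\hat{\mathcal L}$ are assumed invertible. Covariance functions. Let $\Phi$ be the fundamental solution of the state equation ($\Phi(t)=I+\int_0^tA\Phi(s)ds+\sum_i\int_0^tN_i\Phi(s-)dM_i(s)$), $\hat\Phi$ the one with $\hat A,\hat N_i$, and $\Phi_d,\hat\Phi_d$ the fundamental solutions with all of these coefficient matrices transposed. $F(t)=\mathbb E[\Phi(t)X_0X_0^\top\Phi(t)^\top]$, $\tilde F(t)=\mathbb E[\Phi(t)X_0\hat X_0^\top\hat\Phi(t)^\top]$, $G(t)=\mathbb E[\Phi_d(t)C^\top C\Phi_d(t)^\top]$, $\tilde G(t)=\mathbb E[\Phi_d(t)C^\top\hat C\hat\Phi_d(t)^\top]$; equivalently they solve $\dot F=\mathcal L[F]$, $F(0)=X_0X_0^\top$; $\dot{\tilde F}=\tilde{\mathcal L}[\tilde F]$, $\tilde F(0)=X_0\hat X_0^\top$; $\dot G=\mathcal L^*[G]$, $G(0)=C^\top C$; $\dot{\tilde G}=\tilde{\mathcal L}^*[\tilde G]$, $\tilde G(0)=C^\top\hat C$. Set $P(T)=\int_0^TF\,dt$ and $Q(T)=\int_0^TG\,dt$. The diagonalizations may, for example, be eigenvalue decompositions, or, if $P(T),Q(T)>0$,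 the balancing transformation $\mathcal T_P=\mathcal T^{-1}$, $\mathcal T_Q=\mathcal T^\top$ for an invertible $\mathcal T$, with $\Sigma_P(T)=\Sigma_Q(T)$ containing the square roots of the eigenvalues of $P(T)Q(T)$ (Hankel singular values). Sylvester fixed point iteration. One step maps reduced matrices $(\hat A,\hat N_i,\hat X_0,\hat C)$ to new ones as follows. (1) Choose an invertible matrix $S=S(\hat A,\hat X_0,\hat C,\hat N_i)\in\mathbb R^{\hat n\times\hat n}$ and put $\tilde A=S\hat AS^{-1}$, $\tilde X_0=S\hat X_0$, $\tilde C=\hat CS^{-1}$, $\tilde N_i=S\hat N_iS^{-1}$. (2) Let $X,Y:[0,T]\to\mathbb R^{n\times\hat n}$ solve $\dot X=AX+X\tilde A^\top+\sum_{i,j}N_iX\tilde N_j^\top k_{ij}$, $X(0)=X_0\tilde X_0^\top$, and $\dot Y=A^\top Y+Y\tilde A+\sum_{i,j}N_i^\top Y\tilde N_jk_{ij}$, $Y(0)=C^\top\tilde C$. (3) Let $V$ and $W$ be $n\times\hat n$ matrices whose columns are orthonormal bases of $\operatorname{im}[\int_0^TX(t)dt]$ and $\operatorname{im}[\int_0^TY(t)dt]$, respectively (so these integrals have full column rank $\hat n$). (4) With $W^\top V$ invertible, return $\hat A=(W^\top V)^{-1}W^\top AV$, $\hat X_0=(W^\top V)^{-1}W^\top X_0$, $\hat C=CV$, $\hat N_i=(W^\top V)^{-1}W^\top N_iV$. ''Converged'' means that the input and output matrices of a step coincide; $V,W$ are the matrices from step (3) of that step, and $\tilde F,\tilde G$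 are formed with these reduced matrices. *)

(* Defs.v *)
From HB Require Import structures.
From mathcomp Require Import all_boot all_order all_algebra.
From mathcomp Require Import all_classical all_reals all_analysis.
Set Implicit Arguments.
Unset Strict Implicit.
Unset Printing Implicit Defensive.
Import Order.TTheory GRing.Theory Num.Theory.
Import numFieldNormedType.Exports.
Local Open Scope classical_set_scope.
Local Open Scope ring_scope.

(* Coefficients (A, N_1, ..., N_q, X_0, C) of a bilinear stochastic system
     dx = A x dt + \sum_i N_i x dM_i,   x(0) = X_0 v,   y = C x
   of state dimension n, with m initial directions and p outputs.  The full
   system and the reduced one are both of this form. *)
Record system (R : realType) (q m p n : nat) := System {
  sysA : 'M[R]_n;
  sysN : 'I_q -> 'M[R]_n;
  sysX0 : 'M[R]_(n, m);
  sysC : 'M[R]_(p, n)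
}.

(* The covariance matrices K_M of the noise: symmetric positive semidefinite. *)
Definition sym_psd (R : realType) (q : nat) (K : 'M[R]_q) : Prop :=
  K^T = K /\ forall x : 'cV[R]_q, 0 <= (x^T *m K *m x) 0 0.

Section Operators.
Variables (R : realType) (q m p n k : nat) (K : 'M[R]_q).
Variables (s : system R q m p n) (r : system R q m p k).

(* [mixed_op K s r] is the operator of E[Phi_s B Phi_r^T] and [mixed_adj K s r]
   its Frobenius adjoint; s = r gives L and L^*, and s full, r reduced gives
   their mixed (tilde) versions. *)
Definition mixed_op (X : 'M[R]_(n, k)) : 'M[R]_(n, k) :=
  sysA s *m X + X *m (sysA r)^T
  + \sum_(i < q) \sum_(j < q) K i j *: (sysN s i *m X *m (sysN r j)^T).

Definition mixed_adj (X : 'M[R]_(n, k)) : 'M[R]_(n, k) :=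
  (sysA s)^T *m X + X *m sysA r
  + \sum_(i < q) \sum_(j < q) K i j *: ((sysN s i)^T *m X *m sysN r j).

End Operators.

(* Classical solution on [0, T] of X' = L(X), X(0) = B.  Values of X outside
   [0, T] are irrelevant; with continuity on [0, T], the equation on ]0, T[
   gives the one-sided derivatives at the end points. *)
Definition solves_ode (R : realType) (n k : nat) (T : R)
    (L : 'M[R]_(n, k) -> 'M[R]_(n, k)) (B : 'M[R]_(n, k))
    (X : R -> 'M[R]_(n, k)) : Prop :=
  [/\ X 0 = B,
      {within `[0, T], continuous X} &
      forall t : R, 0 < t < T -> is_derive t 1 X (L (X t))].

Section Covariances.
Variables (R : realType) (q m p n k : nat) (T : R) (K : 'M[R]_q).
Variables (s : system R q m p n) (r : system R q m p k).

(* t |-> E[Phi_s(t) X0_s X0_r^T Phi_r(t)^T] on [0, T] *)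
Definition state_covariance (F : R -> 'M[R]_(n, k)) : Prop :=
  solves_ode T (mixed_op K s r) (sysX0 s *m (sysX0 r)^T) F.

(* t |-> E[Phi_(d,s)(t) C_s^T C_r Phi_(d,r)(t)^T] on [0, T], where Phi_d is the
   fundamental solution for the transposed coefficients *)
Definition dual_covariance (G : R -> 'M[R]_(n, k)) : Prop :=
  solves_ode T (mixed_adj K s r) ((sysC s)^T *m sysC r) G.

End Covariances.

Definition mx_integral (R : realType) (n k : nat) (T : R)
    (X : R -> 'M[R]_(n, k)) : 'M[R]_(n, k) :=
  \matrix_(i, j) \int[lebesgue_measure]_(t in `[0, T]) (X t i j).

(* The columns of V form an orthonormal basis of the column space of Z
   (mathcomp's [==]%MS compares row spaces, hence the transposes). *)
Definition orthonormal_im_basis (R : realType) (n k l : nat)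
    (V : 'M[R]_(n, k)) (Z : 'M[R]_(n, l)) : Prop :=
  V^T *m V = 1%:M /\ (V^T == Z^T)%MS.

Definition change_basis (R : realType) (q m p k : nat) (S : 'M[R]_k)
    (r : system R q m p k) : system R q m p k :=
  System (S *m sysA r *m invmx S) (fun i => S *m sysN r i *m invmx S)
         (S *m sysX0 r) (sysC r *m invmx S).

Definition petrov_galerkin (R : realType) (q m p n k : nat)
    (V W : 'M[R]_(n, k)) (s : system R q m p n) : system R q m p k :=
  let U := invmx (W^T *m V) *m W^T in
  System (U *m sysA s *m V) (fun i => U *m sysN s i *m V)
         (U *m sysX0 s) (sysC s *m V).

(* One step of the Sylvester fixed point iteration for the full system s on
   [0, T]: from r it may produce r' through the projection matrices V, W. *)
Definition sylvester_step (R : realType) (q m p n k : nat) (T : R)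
    (K : 'M[R]_q) (s : system R q m p n) (r r' : system R q m p k)
    (V W : 'M[R]_(n, k)) : Prop :=
  exists (S : 'M[R]_k) (X Y : R -> 'M[R]_(n, k)),
    [/\ S \in unitmx,
        state_covariance T K s (change_basis S r) X /\
        dual_covariance T K s (change_basis S r) Y,
        orthonormal_im_basis V (mx_integral T X) /\
        orthonormal_im_basis W (mx_integral T Y),
        W^T *m V \in unitmx &
        r' = petrov_galerkin V W s].

(* Main.v *)
From HB Require Import structures.
Require Import Defs.
From mathcomp Require Import all_boot all_order all_algebra.
From mathcomp Require Import all_classical all_reals all_analysis.
From mathcomp Require Import ring lra.
Import Order.TTheory GRing.Theory Num.Theory.
Import numFieldNormedType.Exports.
Set Implicit Arguments.
Unset Strict Implicit.
Unset Printing Implicit Defensive.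
Local Open Scope classical_set_scope.
Local Open Scope ring_scope.

(** Over the full system the state covariance F solves F' = op(F) with
    F(0) = X0 X0^T >= 0, and P(T) is the integral of F.  The two claims on the
    state side both say that a matrix (Ft(t), respectively V) has its columns
    in the column space of P(T): once such a matrix is written P(T) D, the
    factorization of P(T) splits P(T) D into a part in the first k columns of
    TP and a part in TP2 SigmaP2.  The columns of V span those of the integral
    of a mixed covariance X, so everything reduces to one statement:
    every row vector that annihilates P(T) annihilates the mixed covariance with
    any second system on [0, T] ([mixed_annihilator]).

    The probabilistic reason is Cauchy-Schwarz: v P(T) v^T = 0 means that
    v Phi(t) X0 = 0 almost surely.  The proof below only uses the equations.
    Writing K = G^T G ([sym_psd_gram]) turns the noise term of op into a sum of
    N_a X N_a^T, so that op is a Lyapunov operator ([lyap]).  Such an operator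
    generates a flow that preserves positive semidefinite matrices
    ([lyap_solution_psd]).  Hence v P(T) v^T, the integral of the nonnegative
    continuous function v F(t) v^T, vanishes only if v F(t) = 0 on [0, T]
    ([kermx_F]).  Differentiating this identity shows that the left kernel of
    P(T) annihilates X0 and is invariant under right multiplication by A and
    by all N_a ([kermx_initial], [kermx_invariant]).  If the rows of Z span that
    kernel, Z X(t) therefore solves a homogeneous linear equation with initial
    value zero, and it vanishes by uniqueness ([linear_ode_zero]).

    The dual side is the state side for the transposed system
    ([dual_covarianceE]). *)

(** * Linear images of matrix-valued functions *)

Lemma linear_mx_sum (R : realType) n k (W : lmodType R)
    (f : {linear 'M[R]_(n, k) -> W}) (M : 'M[R]_(n, k)) :
  f M = \sum_i \sum_j M i j *: f (delta_mx i j).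
Proof.
rewrite {1}(matrix_sum_delta M) linear_sum; apply: eq_bigr => i _.
by rewrite linear_sum; apply: eq_bigr => j _; rewrite linearZ.
Qed.

Lemma linear_mx_continuous (R : realType) n k (W : normedModType R)
    (f : {linear 'M[R]_(n, k) -> W}) : continuous f.
Proof.
move=> M.
have -> : (f : _ -> _) = (fun M => \sum_i \sum_j M i j *: f (delta_mx i j)).
  by apply/funext => N; exact: linear_mx_sum.
apply: (cvg_big add_continuous (F := nbhs M)) => i _.
apply: (cvg_big add_continuous (F := nbhs M)) => j _.
by apply: cvgZr_tmp; exact: coord_continuous.
Qed.

Lemma is_derive_cvg (R : realType) n k (X : R -> 'M[R]_(n, k)) (t : R)
    (D : 'M[R]_(n, k)) : is_derive t 1 X D ->
  h^-1 *: (X (h *: 1 + t) - X t) @[h --> (0:R)^'] --> D.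
Proof. by move=> [dX <-]; exact: dX. Qed.

Lemma is_derive_linear_mx (R : realType) n k (W : normedModType R)
    (f : {linear 'M[R]_(n, k) -> W}) (X : R -> 'M[R]_(n, k)) (t : R) D :
  is_derive t 1 X D -> is_derive t 1 (f \o X) (f D).
Proof.
move=> /is_derive_cvg cvX.
have cv : h^-1 *: (f (X (h *: 1 + t)) - f (X t)) @[h --> 0^'] --> f D.
  have := cvg_comp _ _ cvX (@linear_mx_continuous _ _ _ _ f D).
  apply: cvg_trans; apply: near_eq_cvg; near=> h => /=.
  by rewrite linearZ /= linearB.
split; first by apply/cvg_ex; exists (f D).
exact/cvg_lim.
Unshelve. all: by end_near. Qed.

Lemma within_continuous_linear_mx (R : realType) n k (W : normedModType R)
    (f : {linear 'M[R]_(n, k) -> W}) (X : R -> 'M[R]_(n, k)) (A : set R) :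
  {within A, continuous X} -> {within A, continuous (f \o X)}.
Proof.
by move=> cX x; apply: (continuous_comp (cX x)); exact: linear_mx_continuous.
Qed.

Lemma integrable_itv (R : realType) (T : R) (g : R -> R) :
  {within `[0, T], continuous g} ->
  (@lebesgue_measure R).-integrable `[0, T] (EFin \o g).
Proof. by apply: continuous_compact_integrable; exact: segment_compact. Qed.

Lemma Rintegral_sum d (U : measurableType d) (R : realType)
    (mu : {measure set U -> \bar R}) (D : set U) (I : Type) (s : seq I)
    (g : I -> U -> R) :
  measurable D -> (forall i, mu.-integrable D (EFin \o g i)) ->
  mu.-integrable D (EFin \o (fun x => \sum_(i <- s) g i x)) /\
  \int[mu]_(x in D) (\sum_(i <- s) g i x)
    = \sum_(i <- s) \int[mu]_(x in D) g i x.
Proof.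
move=> mD ig; elim: s => [|i s [IH1 IH2]].
  split; last first.
    rewrite big_nil; under eq_Rintegral do rewrite big_nil.
    by rewrite Rintegral_cst// mul0r.
  have -> : EFin \o (fun x => \sum_(i <- [::]) g i x) = cst 0%E.
    by apply/funext => x /=; rewrite big_nil.
  exact: integrable0.
have E : (fun x => \sum_(j <- i :: s) g j x) =
         (fun x => g i x + \sum_(j <- s) g j x).
  by apply/funext => x; rewrite big_cons.
rewrite E; split.
  have -> : EFin \o (fun x => g i x + \sum_(j <- s) g j x) =
    ((EFin \o g i) \+ (EFin \o (fun x => \sum_(j <- s) g j x)%R))%E.
    by apply/funext.
  exact: integrableD.
by rewrite big_cons RintegralD// IH2.
Qed.

(** The integral of a matrix is taken entrywise, and a linear functional is a
    fixed combination of the entries. *)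
Lemma mx_integral_linear (R : realType) n k (T : R)
    (f : {linear 'M[R]_(n, k) -> R^o}) (X : R -> 'M[R]_(n, k)) :
  {within `[0, T], continuous X} ->
  f (mx_integral T X) = \int[lebesgue_measure]_(t in `[0, T]) f (X t).
Proof.
move=> cX.
have iX1 i j : (@lebesgue_measure R).-integrable `[0, T]
    (EFin \o (fun t => X t i j)).
  apply: integrable_itv.
  by move=> t; exact: (continuous_comp (cX t) (@coord_continuous _ _ _ i j _)).
have iX i j : (@lebesgue_measure R).-integrable `[0, T]
    (EFin \o (fun t => f (delta_mx i j) * X t i j)).
  have -> : EFin \o (fun t => f (delta_mx i j) * X t i j) =
    (fun t => (f (delta_mx i j))%:E * (EFin \o (fun t => X t i j)) t)%E.
    by apply/funext => t.
  exact: integrableZl.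
under [RHS]eq_Rintegral => t _.
  rewrite linear_mx_sum /=.
  under eq_bigr => i _ do under eq_bigr => j _ do rewrite /GRing.scale /= mulrC.
  over.
have is_ i : (@lebesgue_measure R).-integrable `[0, T]
    (EFin \o (fun t => \sum_j f (delta_mx i j) * X t i j)).
  exact: (Rintegral_sum (mu := @lebesgue_measure R) _ _ (iX i)).1.
rewrite (Rintegral_sum (mu := @lebesgue_measure R) _ _ is_).2//.
rewrite linear_mx_sum; apply: eq_bigr => i _.
rewrite (Rintegral_sum (mu := @lebesgue_measure R) _ _ (iX i)).2//; apply: eq_bigr => j _.
by rewrite RintegralZl// mxE mulrC.
Qed.

Lemma is_derive_coord (R : realType) n k (X : R -> 'M[R]_(n, k)) (t : R) D i j :
  is_derive t 1 X D -> is_derive t 1 (fun s => X s i j) (D i j).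
Proof.
move=> [dX <-]; split; first exact: (derivable_mxP _ _ _).1.
by rewrite derive_mx// mxE.
Qed.

Lemma is_derive_mx (R : realType) n k (X : R -> 'M[R]_(n, k)) (t : R) (D : 'M[R]_(n, k)) :
  (forall i j, is_derive t 1 (fun s => X s i j) (D i j)) -> is_derive t 1 X D.
Proof.
move=> dX; have dvX : derivable X t 1.
  by apply: (derivable_mxP _ _ _).2 => i j; have [] := dX i j.
split=> //; apply/matrixP => i j; rewrite derive_mx// mxE.
by have [] := dX i j.
Qed.

(** * Integrals and differential inequalities on an interval *)

(** A solution satisfies its equation on the open interval only; by continuity
    sign conditions extend to the end points. *)
Lemma itv_open_close_ge0 (R : realType) (T : R) (g : R -> R) :
  0 < T -> {within `[0, T], continuous g} ->
  (forall t, 0 < t < T -> 0 <= g t) -> forall t, 0 <= t <= T -> 0 <= g t.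
Proof.
move=> T0 /(continuous_within_itvP _ T0)[_ g0 gT] ge t /andP[].
rewrite le_eqVlt => /orP[/eqP<- _|t0].
  have gp := cvgP _ g0.
  rewrite -(cvg_lim (@Rhausdorff R) g0); apply: limr_ge => //.
  near=> s; apply: ge; apply/andP; split=> //.
rewrite le_eqVlt => /orP[/eqP->|tT]; last by rewrite ge// t0.
have gp := cvgP _ gT.
rewrite -(cvg_lim (@Rhausdorff R) gT); apply: limr_ge => //.
by near=> s; apply: ge; apply/andP; split.
Unshelve. all: by end_near. Qed.

Lemma itv_open_close_eq0 (R : realType) (T : R) (g : R -> R) :
  0 < T -> {within `[0, T], continuous g} ->
  (forall t, 0 < t < T -> g t = 0) -> forall t, 0 <= t <= T -> g t = 0.
Proof.
move=> T0 cg g0 t tT; apply/eqP; rewrite eq_le -oppr_ge0; apply/andP; split.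
  apply: (@itv_open_close_ge0 _ T (fun t => - g t)) => //.
    by move=> x; apply: (@cvgN _ R); exact: cg.
  by move=> s sT; rewrite g0// oppr0.
by apply: (@itv_open_close_ge0 _ T) => // s sT; rewrite g0.
Qed.

(** The primitive of g is squeezed between 0 and its value at T, so it is
    constant, and its derivative is g. *)
Lemma Rintegral_ge0_eq0 (R : realType) (T : R) (g : R -> R) :
  0 < T -> {within `[0, T], continuous g} ->
  (forall t, 0 <= t <= T -> 0 <= g t) ->
  \int[lebesgue_measure]_(t in `[0, T]) g t = 0 ->
  forall t, 0 <= t <= T -> g t = 0.
Proof.
move=> T0 cg g0 Ig; apply: itv_open_close_eq0 => // t /andP[t0 tT].
have intg : (@lebesgue_measure R).-integrable `[0, T] (EFin \o g).
  exact: integrable_itv.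
pose G x := \int[lebesgue_measure]_(t in `[0, x]) g t.
have G0 x : 0 < x < T -> G x = 0.
  move=> /andP[x0 xT]; apply/eqP; rewrite eq_le; apply/andP; split.
    have : \int[lebesgue_measure]_(t in `[0, T]) g t - G x =
        \int[lebesgue_measure]_(t in `]x, T]) g t.
      by rewrite Rintegral_itvB// bnd_simp ltW.
    rewrite Ig sub0r -oppr_ge0 => ->.
    apply: Rintegral_ge0 => s /=; rewrite in_itv/= => /andP[xs sT].
    by rewrite g0// sT (le_trans (ltW x0) (ltW xs)).
  apply: Rintegral_ge0 => s /=; rewrite in_itv/= => /andP[s0 sx].
  by rewrite g0// s0 (le_trans sx (ltW xT)).
have ct : {for t, continuous g}.
  move: cg => /(continuous_within_itvP _ T0)[+ _ _]; apply.
  by rewrite in_itv/= t0.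
have [dG <-] := continuous_FTC1_closed tT intg t0 ct.
rewrite -/G derive1E.
have : is_derive t (1 : R) G (0 : R).
  apply: (near_eq_is_derive _ (is_derive_cst (0 : R) t (1 : R))).
  near=> s; rewrite G0//; apply/andP; split; near: s.
    exact: lt_nbhsr.
  exact: lt_nbhsl.
by case.
Unshelve. all: by end_near. Qed.

(** The product e(t) exp(-C t) is nonincreasing. *)
Lemma gronwall0 (R : realType) (T C : R) (e e' : R -> R) :
  {within `[0, T], continuous e} ->
  (forall t : R, 0 < t < T -> is_derive t 1 e (e' t)) ->
  (forall t, 0 < t < T -> e' t <= C * e t) ->
  e 0 <= 0 -> forall t, 0 <= t <= T -> e t <= 0.
Proof.
move=> ce de le_e e0 t /andP[].
rewrite le_eqVlt => /orP[/eqP<- //|t0 tT].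
pose u s : R := e s * expR (- C * s).
have du s : s \in `]0, t[ ->
    is_derive s 1 u ((e' s - C * e s) * expR (- C * s)).
  rewrite in_itv/= => /andP[s0 st].
  have := de s; rewrite s0 (lt_le_trans st tT) => /(_ isT) des.
  have dx : is_derive s 1 (fun s => expR (- C * s)) (expR (- C * s) * - C).
    apply: is_derive1_comp.
    have := is_deriveZ (- C) (is_derive_id s (1 : R)).
    by rewrite /GRing.scale /= mulr1.
  have := is_deriveM des dx.
  rewrite /GRing.scale/= => h; apply: is_derive_eq.
  ring.
have [|c] := @MVT R u _ 0 t t0 du.
  have cu : {within `[0, t], continuous e}.
    by apply: continuous_subspaceW ce; apply: subset_itvl; rewrite bnd_simp.
  have cx : continuous (fun s : R => expR (- C * s)).
    move=> s; apply: continuous_comp; last exact: continuous_expR.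
    by apply: mulrl_continuous.
  move=> x; apply: (@cvgM R); first exact: cu.
  exact: (continuous_subspaceT cx).
rewrite in_itv/= => /andP[c0 ct].
rewrite subr0 => E.
have : u t <= u 0.
  rewrite -subr_le0 E pmulr_lle0// pmulr_lle0 ?expR_gt0// subr_le0.
  by apply: le_e; rewrite c0 (lt_le_trans ct tT).
rewrite /u mulr0 expR0 mulr1 => ut.
by rewrite -(pmulr_lle0 _ (expR_gt0 (- C * t))) (le_trans ut).
Qed.

(** * Lyapunov operators and uniqueness *)

Section Lyap.
Variables (R : realType) (q n k : nat).
Variables (A : 'M[R]_n) (B : 'M[R]_k) (N : 'I_q -> 'M[R]_n) (M : 'I_q -> 'M[R]_k).

(** For B = A and M = N this is the generator of the covariance of a linear
    equation driven by uncorrelated noises of unit variance. *)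
Definition lyap (X : 'M[R]_(n, k)) : 'M[R]_(n, k) :=
  A *m X + X *m B^T + \sum_(a < q) N a *m X *m (M a)^T.

Lemma lyap_is_linear : linear lyap.
Proof.
move=> c X Y; rewrite /lyap.
under eq_bigr do rewrite mulmxDr mulmxDl -scalemxAr -scalemxAl.
rewrite big_split /= -scaler_sumr mulmxDr mulmxDl -scalemxAr -scalemxAl.
by rewrite !scalerDr [RHS]addrACA; congr (_ + _); rewrite addrACA.
Qed.

HB.instance Definition _ :=
  GRing.isLinear.Build R 'M[R]_(n, k) 'M[R]_(n, k) *:%R lyap lyap_is_linear.

End Lyap.

(** If K = L^T L, the noise has the covariance of L^T w for a noise w with
    uncorrelated components of unit variance, and \sum_i L a i N_i is the
    coefficient of the component w_a. *)
Lemma mixed_op_lyap (R : realType) (q m p n k : nat) (L : 'M[R]_q)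
    (s : system R q m p n) (r : system R q m p k) :
  mixed_op (L^T *m L) s r =
  lyap (sysA s) (sysA r) (fun a => \sum_i L a i *: sysN s i)
       (fun a => \sum_i L a i *: sysN r i).
Proof.
apply/funext => X; rewrite /mixed_op /lyap; congr (_ + _).
under [RHS]eq_bigr => a _.
  rewrite !mulmx_suml; under eq_bigr => i _.
    rewrite linear_sum /= mulmx_sumr.
    under eq_bigr => j _ do
      rewrite linearZ /= -scalemxAr -!scalemxAl scalerA mulrC.
    over.
  over.
rewrite [RHS]exchange_big; apply: eq_bigr => i _.
rewrite [RHS]exchange_big; apply: eq_bigr => j _.
rewrite mxE scaler_suml; apply: eq_bigr => a _.
by rewrite mxE.
Qed.

(** Cholesky factorization.  A vanishing pivot a forces the column b below it to
    vanish; otherwise the Schur complement D - b b^T / a is again positive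
    semidefinite. *)
Lemma sym_psd_gram (R : realType) (q : nat) (K : 'M[R]_q) :
  sym_psd K -> exists L : 'M[R]_q, K = L^T *m L.
Proof.
elim: q K => [|q IH] K; first by exists 0; apply/matrixP => -[].
rewrite -[q.+1]/(1 + q)%N in K *.
move=> [Ksym Kpsd].
pose a := K 0 0; pose b := dlsubmx K; pose D := drsubmx K.
have KE : K = block_mx a%:M b^T b D.
  rewrite -[LHS]submxK; congr block_mx.
    apply/matrixP => i j; rewrite !mxE !ord1 /= mulr1n /a.
    by congr (K _ _); apply/val_inj.
  by rewrite -{1}Ksym -trmx_dlsub.
have Dsym : D^T = D by rewrite /D trmx_drsub Ksym.
have Kq (s : R) (y : 'cV[R]_q) :
    0 <= a * s ^+ 2 + 2 * s * (b^T *m y) 0 0 + (y^T *m D *m y) 0 0.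
  have := Kpsd (col_mx s%:M y).
  rewrite KE tr_col_mx mul_row_block mul_row_col tr_scalar_mx.
  have -> : y^T *m b = b^T *m y.
    rewrite -[LHS]trmxK trmx_mul trmxK [b^T *m y]mx11_scalar.
    by rewrite tr_scalar_mx.
  rewrite !mul_scalar_mx mul_mx_scalar mulmxDl -scalemxAl.
  move: (b^T *m y) (y^T *m D *m y) => U Z.
  rewrite !mxE !mulr1n => h; apply: le_trans h _.
  by rewrite le_eqVlt; apply/orP; left; apply/eqP; ring.
have D_psd (y : 'cV[R]_q) : 0 <= (y^T *m D *m y) 0 0.
  by have := Kq 0 y; rewrite expr0n !mulr0 mul0r !add0r.
have a_ge0 : 0 <= a.
  by have := Kq 1 0; rewrite expr1n !mulmx0 !mxE mulr0 !addr0 mulr1.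
have [a0|a0] := eqVneq a 0.
  have b0 : b = 0.
    have bb : (b^T *m b) 0 0 = 0.
      set d := (b^T *m b) 0 0; set e := (b^T *m D *m b) 0 0.
      have d0 : 0 <= d by rewrite /d mxE sumr_ge0// => i _; rewrite mxE -expr2 sqr_ge0.
      apply/eqP; rewrite eq_le d0 andbT leNgt; apply/negP => dp.
      (* Since a = 0 the form is affine in the first coordinate, with slope 2 d
         when the others are b; this coordinate makes it negative. *)
      have := Kq (- (e + 1) / d) b.
      rewrite -/d -/e a0 mul0r add0r.
      have -> : 2 * (- (e + 1) / d) * d + e = - e - 2 by field; rewrite gt_eqF.
      have := D_psd b; rewrite -/e; lra.
    apply/matrixP => i j; rewrite ord1 [RHS]mxE; apply/eqP.
    rewrite -sqrf_eq0; move: bb; rewrite mxE => /eqP.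
    under eq_bigr do rewrite mxE -expr2.
    rewrite psumr_eq0 => [/allP/(_ i)|? _]; last exact: sqr_ge0.
    by rewrite mem_index_enum => /(_ isT)/implyP/(_ isT).
  have [L DL] := IH D (conj Dsym D_psd).
  exists (block_mx 0 0 0 L).
  rewrite tr_block_mx mulmx_block !(trmx0, mulmx0, mul0mx, add0r, addr0) -DL.
  by rewrite KE a0 b0 trmx0; congr block_mx; apply/matrixP => i j; rewrite !mxE mul0rn.
pose r := Num.sqrt a.
have r2 : r * r = a by rewrite -expr2 sqr_sqrtr.
have ap : 0 < a by rewrite lt_neqAle eq_sym a0.
have r0 : r != 0 by rewrite gt_eqF// sqrtr_gt0.
have [|L DL] := IH (D - a^-1 *: (b *m b^T)).
  split.
    by rewrite linearB linearZ /= trmx_mul trmxK Dsym.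
  (* This first coordinate minimizes the form for given y; the minimum is the
     value of the Schur complement at y. *)
  move=> y; have := Kq (- (b^T *m y) 0 0 / a) y.
  have -> : (y^T *m (D - a^-1 *: (b *m b^T)) *m y) 0 0 =
      (y^T *m D *m y) 0 0 - a^-1 * (b^T *m y) 0 0 ^+ 2.
    rewrite mulmxBr mulmxBl -scalemxAr -scalemxAl.
    have bT : y^T *m b = b^T *m y.
      rewrite -[LHS]trmxK trmx_mul trmxK [b^T *m y]mx11_scalar.
      by rewrite tr_scalar_mx.
    have -> : y^T *m (b *m b^T) *m y = (b^T *m y) *m (b^T *m y).
      by rewrite mulmxA bT !mulmxA.
    move: (b^T *m y) (y^T *m D *m y) => U Z.
    rewrite [X in X *m _]mx11_scalar mul_scalar_mx.
    by rewrite !mxE expr2.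
  move: ((b^T *m y) 0 0) ((y^T *m D *m y) 0 0) => u z h.
  apply: le_trans h _; rewrite le_eqVlt; apply/orP; left; apply/eqP.
  by field.
exists (block_mx r%:M (r^-1 *: b^T) 0 L).
rewrite tr_block_mx mulmx_block !(trmx0, mulmx0, mul0mx, add0r, addr0) -DL.
rewrite tr_scalar_mx -scalar_mxM r2 KE [(_ *: _)^T]linearZ /= trmxK; congr block_mx.
- by rewrite mul_scalar_mx scalerA divff// scale1r.
- by rewrite -scalemxAl mul_mx_scalar scalerA mulVf// scale1r.
- rewrite -scalemxAl -scalemxAr scalerA -invfM r2; apply/eqP.
  by rewrite addrC subrK.
Qed.

(** C is the sum of the absolute values of all the coefficients of f, since
    |x y| <= x^2 + y^2 for any two entries. *)
Lemma linear_energy_bound (R : realType) n k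
    (f : {linear 'M[R]_(n, k) -> 'M[R]_(n, k)}) :
  exists C, forall X : 'M[R]_(n, k),
    \sum_i \sum_j X i j * f X i j <= C * \sum_i \sum_j X i j ^+ 2.
Proof.
exists (\sum_i \sum_j \sum_a \sum_b `|f (delta_mx a b) i j|) => X.
set E := \sum_i \sum_j X i j ^+ 2.
have XE i j : X i j ^+ 2 <= E.
  rewrite /E (bigD1 i)//= (bigD1 j)//= -addrA lerDl addr_ge0//.
    by rewrite sumr_ge0// => *; rewrite sqr_ge0.
  by do 2![rewrite sumr_ge0// => *]; rewrite sqr_ge0.
rewrite mulr_suml; apply: ler_sum => i _.
rewrite mulr_suml; apply: ler_sum => j _.
rewrite linear_mx_sum summxE mulr_sumr mulr_suml; apply: ler_sum => a _.
rewrite summxE mulr_sumr mulr_suml; apply: ler_sum => b _.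
rewrite mxE; set c := f _ i j.
have XX : `|X i j * X a b| <= E.
  have := XE i j; have := XE a b.
  have := sqr_ge0 (X i j - X a b); have := sqr_ge0 (X i j + X a b).
  rewrite ler_norml; move: (X i j) (X a b) => u v ? ? ? ?; apply/andP; split; nra.
rewrite mulrA; apply: le_trans (ler_norm _) _; rewrite normrM mulrC.
by apply: ler_wpM2l.
Qed.

(** The energy, the squared Frobenius norm of X, satisfies e' <= 2 C e. *)
Lemma linear_ode_zero (R : realType) n k (T : R)
    (f : {linear 'M[R]_(n, k) -> 'M[R]_(n, k)}) (X : R -> 'M[R]_(n, k)) :
  solves_ode T f 0 X -> forall t, 0 <= t <= T -> X t = 0.
Proof.
move=> [X0 cX dX] t tT.
have [C fC] := linear_energy_bound f.
pose e s := \sum_i \sum_j X s i j ^+ 2.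
have : e t <= 0.
  apply: (@gronwall0 _ T (2 * C) e
    (fun s => 2 * \sum_i \sum_j X s i j * f (X s) i j)) tT.
  - move=> x; apply: (@cvg_big _ _ _ _ _ add_continuous) => i _.
    apply: (@cvg_big _ _ _ _ _ add_continuous) => j _.
    have cc := continuous_comp (cX x) (@coord_continuous _ _ _ i j _).
    exact: (continuous_comp cc (@exprn_continuous R 2 _)).
  - move=> s sT.
    rewrite mulr_sumr.
    have -> : e = \sum_i (fun s => \sum_j X s i j ^+ 2).
      by apply/funext => u; rewrite fct_sumE.
    apply: is_derive_sum => i; rewrite mulr_sumr.
    have -> : (fun s => \sum_j X s i j ^+ 2) = \sum_j (fun s => X s i j) ^+ 2.
      by apply/funext => u; rewrite fct_sumE.
    apply: is_derive_sum => j.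
    have h := is_deriveX 2 (is_derive_coord i j (dX s sT)).
    by apply: is_derive_eq; rewrite /GRing.scale /= expr1 mulrA.
  - by move=> s sT; rewrite -mulrA ler_pM2l.
  by rewrite /e X0 big1// => i _; rewrite big1// => j _; rewrite mxE expr0n.
move=> et; apply/matrixP => i j; rewrite [RHS]mxE; apply/eqP.
rewrite -sqrf_eq0 eq_le sqr_ge0 andbT (le_trans _ et)//.
rewrite /e (bigD1 i)//= (bigD1 j)//= -addrA lerDl addr_ge0//.
  by rewrite sumr_ge0// => *; rewrite sqr_ge0.
by do 2![rewrite sumr_ge0// => *]; rewrite sqr_ge0.
Qed.

(** * Positivity of the covariance flow *)

(** Look at the infimum of the points of [0, T[ where P fails. *)
Lemma real_induction (R : realType) (T : R) (P : R -> Prop) :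
  P 0 ->
  (forall t, 0 < t < T -> (forall s, 0 <= s < t -> P s) -> P t) ->
  (forall t, 0 <= t < T -> P t ->
    exists2 d, 0 < d & forall s, t < s < t + d -> P s) ->
  forall t, 0 <= t < T -> P t.
Proof.
move=> P0 Pcl Pop t /andP[t0 tT]; apply: contrapT => nPt.
pose S := [set s | 0 <= s < T /\ ~ P s].
have St : S t by split; rewrite // t0.
have lbS : lbound S 0 by move=> s [/andP[]].
have hiS : has_inf S by split; [exists t | exists 0].
pose a := inf S.
have a0 : 0 <= a by apply: lb_le_inf => //; exists t.
have aT : a < T by apply: le_lt_trans tT; by apply: ge_inf => //; exists 0.
have Plt s : 0 <= s < a -> P s.
  move=> /andP[s0 sa]; apply: contrapT => nPs.
  have : a <= s by apply: ge_inf; [exists 0|split=> //; rewrite s0 (lt_trans sa)].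
  by rewrite leNgt sa.
have Pa : P a.
  move: a0; rewrite le_eqVlt => /orP[/eqP<- //|a0].
  by apply: Pcl; rewrite // a0.
have [|d d0 Pd] := Pop a _ Pa; first by rewrite a0.
suff : a + d <= a by rewrite leNgt ltrDl d0.
apply: lb_le_inf; first by exists t.
move=> s [/andP[s0 sT] nPs]; rewrite leNgt; apply/negP => sad.
have : a <= s by apply: ge_inf; [exists 0|split=> //; rewrite s0].
rewrite le_eqVlt => /orP[/eqP as_|as_]; first by apply: nPs; rewrite -as_.
by apply: nPs; apply: Pd; rewrite as_.
Qed.

Section Positivity.
Variables (R : realType) (q n : nat) (A : 'M[R]_n) (N : 'I_q -> 'M[R]_n).

Definition qf (x : 'cV[R]_n) (X : 'M[R]_n) : R^o := (x^T *m X *m x) 0 0.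

Lemma qf_is_linear x : linear (qf x).
Proof.
by move=> c X Y; rewrite /qf mulmxDr mulmxDl -scalemxAr -scalemxAl !mxE.
Qed.

HB.instance Definition _ x :=
  GRing.isLinear.Build R 'M[R]_n R^o *:%R (qf x) (qf_is_linear x).

Definition sqn (x : 'cV[R]_n) : R := \sum_i x i 0 ^+ 2.

Lemma sqn_ge0 x : 0 <= sqn x.
Proof. by apply: sumr_ge0 => i _; rewrite sqr_ge0. Qed.

Lemma qf1 x : qf x 1%:M = sqn x.
Proof.
by rewrite /qf mulmx1 mxE; apply: eq_bigr => i _; rewrite mxE -expr2.
Qed.

Lemma qf_congr x (B X : 'M[R]_n) : qf x (B *m X *m B^T) = qf (B^T *m x) X.
Proof. by rewrite /qf trmx_mul trmxK !mulmxA. Qed.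

Lemma qf_bound x (X : 'M[R]_n) : `|qf x X| <= (n * n)%:R * `|X| * sqn x.
Proof.
rewrite -mulrA natrM -mulrA mulr_natl -[X in _ *+ X](card_ord n) -sumr_const.
rewrite /qf mxE; apply: le_trans (ler_norm_sum _ _ _) _; apply: ler_sum => j _.
rewrite mulr_natl -[X in _ *+ X](card_ord n) -sumr_const.
rewrite mxE mulr_suml; apply: le_trans (ler_norm_sum _ _ _) _.
apply: ler_sum => i _; rewrite !mxE.
have XE : `|X i j| <= `|X|.
  rewrite [leRHS]/Num.Def.normr/= mx_normrE.
  exact: (le_bigmax _ (fun p : 'I_n * 'I_n => `|X p.1 p.2|) (i, j)).
have xE a : x a 0 ^+ 2 <= sqn x.
  rewrite /sqn (bigD1 a)//= lerDl sumr_ge0// => *.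
  exact: sqr_ge0.
have xx : `|x i 0 * x j 0| <= sqn x.
  have := xE i; have := xE j.
  have := sqr_ge0 (x i 0 - x j 0); have := sqr_ge0 (x i 0 + x j 0).
  rewrite ler_norml; move: (x i 0) (x j 0) => u v ? ? ? ?; apply/andP; split; nra.
by rewrite mulrAC normrM mulrC; apply: ler_pM.
Qed.

(** Completing A X + X A^T to a congruence by 1 + h A costs a term of second
    order in h only.  This is what makes an explicit Euler step almost preserve
    positivity. *)
Lemma qf_lyap x (X : 'M[R]_n) (h : R) :
  qf x (X + h *: lyap A A N N X) =
  qf ((1%:M + h *: A)^T *m x) X + h * (\sum_a qf ((N a)^T *m x) X)
  - h ^+ 2 * qf x (A *m X *m A^T).
Proof.
have E : X + h *: lyap A A N N X = (1%:M + h *: A) *m X *m (1%:M + h *: A)^T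
    + h *: (\sum_a N a *m X *m (N a)^T) - h ^+ 2 *: (A *m X *m A^T).
  rewrite /lyap [(1%:M + _)^T]linearD /= trmx1 [(h *: A)^T]linearZ /=.
  rewrite !mulmxDl !mulmxDr mul1mx !mulmx1 -!scalemxAl -!scalemxAr scalerA -expr2.
  by rewrite !scalerDr !addrA [RHS]addrAC addrK; congr (_ + _); rewrite addrAC.
rewrite E linearB linearD !linearZ linear_sum /= qf_congr.
by under eq_bigr do rewrite qf_congr.
Qed.

Let kappa : R := (n * n)%:R.

Lemma psd_lyap_step (X : 'M[R]_n) (h : R) x : 0 <= h ->
  (forall y, 0 <= qf y X) ->
  - (h ^+ 2 * (kappa * `|A *m X *m A^T| * sqn x)) <= qf x (X + h *: lyap A A N N X).
Proof.
move=> h0 X0; rewrite qf_lyap -[leLHS]add0r lerD//.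
  by rewrite addr_ge0// mulr_ge0// sumr_ge0.
rewrite lerN2 ler_wpM2l ?sqr_ge0//.
by apply: le_trans (qf_bound _ _); exact: ler_norm.
Qed.

(** F is compared with E = F + eps exp(c t) 1, where c is so large that E is
    pushed strictly inside the cone: E' = L(E) + eta (c 1 - L(1)) with
    c 1 - L(1) >= 1 and eta = eps exp(c t).  If E(t) >= 0, an Euler step from
    E(t) stays in the cone up to an error h^2 ([psd_lyap_step]), the
    linearization of E has an error o(h), and the push contributes at least
    h eta |x|^2; so E remains positive just after t.  Real induction gives
    E >= 0, and eps is arbitrary. *)
Lemma lyap_solution_psd (T : R) (B : 'M[R]_n) (F : R -> 'M[R]_n) : 0 < T ->
  (forall x, 0 <= qf x B) -> solves_ode T (lyap A A N N) B F ->
  forall t, 0 <= t <= T -> forall x, 0 <= qf x (F t).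
Proof.
move=> T0 B0 [F0 cF dF].
pose L := lyap A A N N.
pose c := kappa * `|L 1%:M| + 1.
have kappa0 : 0 <= kappa by exact: ler0n.
have c0 : 0 <= c by rewrite addr_ge0// mulr_ge0.
have cL x : sqn x <= c * sqn x - qf x (L 1%:M).
  rewrite lerBrDl /c mulrDl mul1r lerD2r.
  by apply: le_trans (qf_bound _ _); exact: ler_norm.
pose E (eps t : R) := F t + (eps * expR (c * t)) *: (1%:M : 'M[R]_n).
have qE eps t x : qf x (E eps t) = qf x (F t) + eps * expR (c * t) * sqn x.
  by rewrite linearD linearZ /= qf1.
have dE eps (t : R) : 0 < t < T -> is_derive t 1 (E eps)
    (L (E eps t) + (eps * expR (c * t)) *: (c%:M - L 1%:M)).
  have LE : L (E eps t) = L (F t) + (eps * expR (c * t)) *: L 1%:M.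
    by rewrite /L linearD linearZ.
  move=> tT; rewrite LE scalerBr -addrA [X in _ + X]addrC subrK.
  apply: is_deriveD; first exact: dF.
  apply: is_derive_mx => i j; rewrite !mxE.
  have dx : is_derive t 1 (fun s => expR (c * s)) (expR (c * t) * c).
    apply: is_derive1_comp.
    by have := is_deriveZ c (is_derive_id t (1 : R)); rewrite /GRing.scale /= mulr1.
  have h := is_deriveZ (eps * (i == j)%:R) dx.
  have -> : (fun s => ((eps * expR (c * s)) *: (1%:M : 'M[R]_n)) i j) =
     (eps * (i == j)%:R) \*: (fun s => expR (c * s)).
    by apply/funext => s; rewrite !mxE mulrAC.
  apply: is_derive_eq; rewrite -[LHS]/(_ * _) -[c *+ _]mulr_natr; ring.
have Epsd eps : 0 < eps -> forall t, 0 <= t < T -> forall x, 0 <= qf x (E eps t).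
  move=> e0; apply: real_induction.
  - move=> x; rewrite qE F0 addr_ge0// mulr_ge0 ?sqn_ge0//.
    by rewrite mulr_ge0 ?expR_ge0// ltW.
  - move=> t /andP[t0 tT] IH x.
    have tT' : 0 < t < T by rewrite t0.
    have [dv _] := is_derive_linear_mx (qf x) (dE eps t tT').
    have ct : {for t, continuous (qf x \o E eps)}.
      by apply: differentiable_continuous; exact/derivable1_diffP.
    have cl := cvg_at_left_filter ct.
    rewrite -[qf x _]/((qf x \o E eps) t) -(cvg_lim (@Rhausdorff R) cl).
    apply: limr_ge; first exact: cvgP cl.
    near=> s; apply: IH; apply/andP; split; near: s.
      by apply: nbhs_left_ge.
    exact: nbhs_left_lt.
  - move=> t /andP[]; rewrite le_eqVlt => /orP[/eqP<- _ _|t0 tT Pt].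
      (* At t = 0 there is no derivative, but E(0) >= eps 1 leaves room for
         continuity. *)
      have [_ + _] := (continuous_within_itvP _ T0).1 cF.
      have r0 : 0 < eps / (kappa + 1) by rewrite divr_gt0// ltr_wpDl.
      move=> /cvgrPdist_lt /(_ _ r0)[d /= d0 Hd].
      exists d => // s /andP[s0 sd] x.
      rewrite add0r in sd; rewrite qE.
      have Fs : `|F 0 - F s| < eps / (kappa + 1).
        by apply: Hd => //=; rewrite sub0r normrN gtr0_norm.
      have -> : F s = F 0 - (F 0 - F s) by rewrite opprB addrC subrK.
      rewrite linearB /= F0 -addrA addr_ge0// addrC subr_ge0 -F0.
      apply: le_trans (ler_norm _) _; apply: le_trans (qf_bound _ _) _.
      apply: ler_wpM2r; first exact: sqn_ge0.
      have ex1 : 1 <= expR (c * s) by rewrite -expR0 ler_expR mulr_ge0// ltW.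
      apply: (@le_trans _ _ eps); last by rewrite ler_peMr// ltW.
      apply: (@le_trans _ _ (kappa * (eps / (kappa + 1)))).
        by apply: ler_wpM2l => //; exact: ltW.
      rewrite mulrCA ler_piMr ?(ltW e0)// ler_pdivrMr ?mul1r ?lerDl//.
      by rewrite ltr_wpDl.
    have tT' : 0 < t < T by rewrite t0.
    pose eta := eps * expR (c * t).
    have eta0 : 0 < eta by rewrite mulr_gt0 ?expR_gt0.
    pose M := `|A *m E eps t *m A^T|.
    have r0 : 0 < eta / (2 * (kappa + 1)) by rewrite divr_gt0// mulr_gt0// ltr_wpDl.
    have Mge0 : 0 <= M by exact: normr_ge0.
    have M0 : 0 < kappa * M + 1 by rewrite ltr_wpDl// mulr_ge0.
    set D := L (E eps t) + eta *: (c%:M - L 1%:M).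
    have /cvgrPdist_lt := is_derive_cvg (dE eps t tT').
    rewrite -/eta -/D => /(_ _ r0)[d /= d0 Hd].
    exists (Num.min d (eta / (2 * (kappa * M + 1)))).
      by rewrite lt_min d0 divr_gt0// mulr_gt0.
    move=> s /andP[ts]; rewrite -ltrBlDl lt_min => /andP[hd hM] x.
    set h := s - t in hd hM.
    have h0 : 0 < h by rewrite subr_gt0.
    have Rm := Hd h _ (lt0r_neq0 h0).
    rewrite /= sub0r normrN gtr0_norm// in Rm.
    have {Rm} := Rm hd.
    rewrite -[h *: 1]/(h * 1) mulr1 subrK.
    set Rm := D - _ => Rmr.
    (* Rm is the error of the difference quotient. *)
    have -> : E eps s = (E eps t + h *: L (E eps t)) + (h * eta) *: (c%:M - L 1%:M)
        - h *: Rm.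
      have hRm : h *: Rm = h *: D - (E eps s - E eps t).
        by rewrite /Rm scalerBr scalerA divff ?gt_eqF// scale1r.
      rewrite hRm opprB -[X in X + _]addrA -scalerA -scalerDr -/D addrACA subrr.
      by rewrite addr0 addrC subrK.
    rewrite linearB linearD !linearZ linearB /= -[c%:M]scalemx1 linearZ /= qf1.
    have step := psd_lyap_step x (ltW h0) Pt.
    have := cL x.
    have := le_trans (ler_norm _) (qf_bound x Rm).
    have : kappa * `|Rm| <= eta / 2.
      apply: le_trans (ler_wpM2l kappa0 (ltW Rmr)) _.
      have -> : kappa * (eta / (2 * (kappa + 1))) = eta / 2 * (kappa / (kappa + 1)).
        by field; rewrite gt_eqF// ltr_wpDl.
      rewrite ler_piMr ?divr_ge0 ?(ltW eta0)//.
      by rewrite ler_pdivrMr ?mul1r ?lerDl// ltr_wpDl.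
    have : h * (kappa * M) <= eta / 2.
      have : h * (2 * (kappa * M + 1)) < eta.
        by rewrite -ltr_pdivlMr// mulr_gt0.
      have : 0 <= h by exact: ltW.
      by move: (kappa * M) => z ? ?; lra.
    move: step; rewrite -/M -/L /GRing.scale /=.
    have := sqn_ge0 x; rewrite -/kappa.
    move: (sqn x) (qf x Rm) (qf x (L 1%:M)) (qf x (E eps t + _)) (kappa * `|Rm|) (kappa * M).
    move=> S a b e u v S0 He Hv Hu Ha Hb.
    have H1 : h * eta * S <= h * eta * (c * S - b).
      by apply: ler_wpM2l Hb; rewrite mulr_ge0// ltW.
    have H2 : h * a <= h * (eta / 2 * S).
      apply: ler_wpM2l; first exact: ltW.
      by apply: le_trans Ha _; exact: ler_wpM2r.
    have H3 : h ^+ 2 * (v * S) <= h * (eta / 2 * S).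
      rewrite expr2 -mulrA; apply: ler_wpM2l; first exact: ltW.
      by rewrite mulrA; exact: ler_wpM2r.
    have -> : h * - a = - (h * a) by rewrite mulrN.
    have hS : h * (eta / 2 * S) = h * eta * S / 2 by ring.
    rewrite !hS in H2 H3.
    move: (h * a) (h ^+ 2 * (v * S)) (h * eta * S) (h * eta * (c * S - b)) e
      He H1 H2 H3 => z1 z2 z3 z4 z5.
    move=> ? ? ? ?; lra.
have Fpsd t x : 0 < t < T -> 0 <= qf x (F t).
  move=> /andP[t0 tT]; rewrite leNgt; apply/negP => Fneg.
  (* With this eps the perturbation makes up for at most half of the negative
     value of the form. *)
  pose eps := - qf x (F t) / (2 * (expR (c * t) * sqn x + 1)).
  have d0 : 0 < expR (c * t) * sqn x + 1.
    by rewrite ltr_wpDl// mulr_ge0 ?expR_ge0 ?sqn_ge0.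
  have e0 : 0 < eps by rewrite divr_gt0 ?oppr_gt0// mulr_gt0.
  have := Epsd eps e0 t; rewrite (ltW t0) tT => /(_ isT x).
  rewrite qE -mulrA; set d := expR _ * _ in d0 *.
  have -> : eps = - qf x (F t) / (2 * (d + 1)) by [].
  set z := qf x (F t) in Fneg *.
  have : - z / (2 * (d + 1)) * d <= - z / 2.
    have -> : - z / (2 * (d + 1)) * d = - z / 2 * (d / (d + 1)).
      by field; rewrite gt_eqF.
    rewrite ler_piMr ?divr_ge0 ?oppr_ge0 ?(ltW Fneg)//.
    by rewrite ler_pdivrMr// mul1r lerDl.
  lra.
move=> t tT x.
apply: (@itv_open_close_ge0 _ T (fun t => qf x (F t))) tT => //.
  exact: (within_continuous_linear_mx (f := qf x) cF).
by move=> s sT; exact: Fpsd.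
Unshelve. all: by end_near. Qed.

End Positivity.

(** * The left kernel of the integrated covariance *)

Section Entry.
Variables (R : realType) (n k : nat) (i : 'I_n) (j : 'I_k).

(** A coordinate with values in R^o, so that it is a linear map. *)
Definition entry (X : 'M[R]_(n, k)) : R^o := X i j.

Lemma entry_is_linear : linear entry.
Proof. by move=> c X Y; rewrite /entry !mxE. Qed.

HB.instance Definition _ :=
  GRing.isLinear.Build R 'M[R]_(n, k) R^o *:%R entry entry_is_linear.

End Entry.

Lemma mulmx_integral_eq0 (R : realType) n k d (T : R) (W : 'M[R]_(d, n))
    (X : R -> 'M[R]_(n, k)) : 0 < T -> {within `[0, T], continuous X} ->
  (forall t, 0 < t < T -> W *m X t = 0) -> W *m mx_integral T X = 0.
Proof.
move=> T0 cX WX; apply/matrixP => i j; rewrite [RHS]mxE.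
rewrite -[LHS]/((entry i j \o mulmx W) _) mx_integral_linear//.
have h : {in `[0, T]%classic, (entry i j \o mulmx W) \o X =1 cst 0}.
  move=> t; rewrite inE/= in_itv/= => tT.
  apply: (@itv_open_close_eq0 R T ((entry i j \o mulmx W) \o X)) => //.
    exact: (within_continuous_linear_mx (f := entry i j \o mulmx W) cX).
  by move=> s sT /=; rewrite WX// /entry mxE.
transitivity (\int[lebesgue_measure]_(t in `[0, T]) (cst 0 t : R)).
  exact: eq_Rintegral.
by rewrite Rintegral_cst// mul0r.
Qed.

Lemma solves_ode_linear (R : realType) n k n' k' (T : R)
    (f : {linear 'M[R]_(n, k) -> 'M[R]_(n', k')})
    (L : 'M[R]_(n, k) -> 'M[R]_(n, k)) (L' : 'M[R]_(n', k') -> 'M[R]_(n', k'))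
    B (X : R -> 'M[R]_(n, k)) : (forall M, f (L M) = L' (f M)) ->
  solves_ode T L B X -> solves_ode T L' (f B) (f \o X).
Proof.
move=> fL [X0 cX dX]; split; first by rewrite /= X0.
  exact: within_continuous_linear_mx.
by move=> t tT; rewrite /= -fL; apply: is_derive_linear_mx; exact: dX.
Qed.

Lemma sum_mul_tr_eq0 (R : realType) (q n k : nat) (M : 'I_q -> 'M[R]_(n, k)) :
  \sum_a M a *m (M a)^T = 0 -> forall a, M a = 0.
Proof.
move=> /matrixP M0 a; apply/matrixP => i j; rewrite [RHS]mxE.
have /eqP := M0 i i; rewrite summxE [X in _ == X]mxE.
under eq_bigr do rewrite mxE.
under eq_bigr do under eq_bigr do rewrite mxE -expr2.
rewrite psumr_eq0 => [/allP/(_ a)|b _]; last first.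
  by rewrite sumr_ge0// => *; exact: sqr_ge0.
rewrite mem_index_enum => /(_ isT)/implyP/(_ isT).
rewrite psumr_eq0 => [/allP/(_ j)|b _]; last exact: sqr_ge0.
by rewrite mem_index_enum => /(_ isT)/implyP/(_ isT); rewrite sqrf_eq0 => /eqP.
Qed.

Lemma mul_tr_eq0 (R : realType) (n k : nat) (M : 'M[R]_(n, k)) :
  M *m M^T = 0 -> M = 0.
Proof.
move=> M0; apply: (@sum_mul_tr_eq0 R 1 n k (fun=> M) _ ord0).
by rewrite big_ord1.
Qed.

Lemma sym_psd_null (R : realType) n (X : 'M[R]_n) x :
  sym_psd X -> qf x X = 0 -> X *m x = 0.
Proof.
move=> /sym_psd_gram[L ->]; rewrite /qf => Lx.
suff E : (L *m x)^T = 0 by rewrite -mulmxA -[L *m x]trmxK E trmx0 mulmx0.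
apply: mul_tr_eq0; rewrite trmxK [LHS]mx11_scalar.
have -> : (L *m x)^T *m (L *m x) = x^T *m (L^T *m L) *m x.
  by rewrite trmx_mul !mulmxA.
by rewrite Lx raddf0.
Qed.

Lemma lyap_solution_sym (R : realType) (q n : nat) (A : 'M[R]_n)
    (N : 'I_q -> 'M[R]_n) (T : R) (B : 'M[R]_n) (F : R -> 'M[R]_n) :
  B^T = B -> solves_ode T (lyap A A N N) B F ->
  forall t, 0 <= t <= T -> (F t)^T = F t.
Proof.
move=> Bs sF t tT; apply/esym/eqP; rewrite -subr_eq0; apply/eqP.
pose f : {linear 'M[R]_n -> 'M[R]_n} := idfun \- trmx.
have fL M : f (lyap A A N N M) = lyap A A N N (f M).
  rewrite /f /= linearB /=; congr (_ - _).
  rewrite /lyap !linearD /= !trmx_mul trmxK linear_sum /=.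
  congr (_ + _); first by rewrite addrC.
  by apply: eq_bigr => a _; rewrite !trmx_mul trmxK mulmxA.
have := solves_ode_linear fL sF; rewrite /f /= Bs subrr => s0.
exact: (linear_ode_zero s0).
Qed.

Lemma lyap_intertwine (R : realType) (q n k d : nat) (Z : 'M[R]_(d, n))
    (A : 'M[R]_n) (N : 'I_q -> 'M[R]_n) (A1 : 'M[R]_d) (N1 : 'I_q -> 'M[R]_d)
    (Ar : 'M[R]_k) (Nr : 'I_q -> 'M[R]_k) (X : 'M[R]_(n, k)) :
  Z *m A = A1 *m Z -> (forall a, Z *m N a = N1 a *m Z) ->
  Z *m lyap A Ar N Nr X = lyap A1 Ar N1 Nr (Z *m X).
Proof.
move=> ZA ZN; rewrite /lyap !mulmxDr mulmx_sumr !mulmxA ZA; congr (_ + _).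
by apply: eq_bigr => a _; rewrite !mulmxA ZN.
Qed.

Section Reachable.
Variables (R : realType) (q n k m : nat) (T : R).
Variables (A : 'M[R]_n) (N : 'I_q -> 'M[R]_n) (Ar : 'M[R]_k) (Nr : 'I_q -> 'M[R]_k).
Variables (B : 'M[R]_(n, m)) (Br : 'M[R]_(k, m)).
Variables (F : R -> 'M[R]_n) (X : R -> 'M[R]_(n, k)).
Hypothesis T0 : 0 < T.
Hypothesis sF : solves_ode T (lyap A A N N) (B *m B^T) F.

Let P := mx_integral T F.
Let Z := kermx P.

Lemma covariance_sym_psd t : 0 <= t <= T -> sym_psd (F t).
Proof.
move=> tT; split.
  by apply: (lyap_solution_sym _ sF tT); rewrite trmx_mul trmxK.
move=> x; apply: (lyap_solution_psd T0 _ sF tT) => y.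
have -> : qf y (B *m B^T) = ((B^T *m y)^T *m (B^T *m y)) 0 0.
  by rewrite /qf trmx_mul trmxK !mulmxA.
by rewrite mxE sumr_ge0// => i _; rewrite mxE -expr2 sqr_ge0.
Qed.

(** For a row v of Z the nonnegative function v F(t) v^T has integral
    v P v^T = 0. *)
Lemma kermx_F t : 0 <= t <= T -> Z *m F t = 0.
Proof.
move=> tT; apply/row_matrixP => i; rewrite row_mul row0.
pose v := (row i Z)^T.
have vP : row i Z *m P = 0 by rewrite -row_mul mulmx_ker row0.
have cF : {within `[0, T], continuous F} by case: sF.
have qP : \int[lebesgue_measure]_(s in `[0, T]) qf v (F s) = 0.
  by rewrite -(mx_integral_linear (qf v))//= /qf /v trmxK vP mul0mx mxE.
have qF := Rintegral_ge0_eq0 T0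
  (within_continuous_linear_mx (f := qf v) cF)
  (fun s sT => (covariance_sym_psd sT).2 v) qP.
have [Fs _] := covariance_sym_psd tT.
have := sym_psd_null (covariance_sym_psd tT) (qF t tT).
by move/(congr1 trmx); rewrite trmx_mul trmxK Fs trmx0.
Qed.

Lemma kermx_initial : Z *m B = 0.
Proof.
apply: mul_tr_eq0; rewrite trmx_mul -mulmxA [B *m _]mulmxA.
have [<- _ _] := sF; rewrite mulmxA kermx_F ?mul0mx//.
by rewrite lexx ltW.
Qed.

Lemma kermx_lyap_F t : 0 < t < T -> Z *m lyap A A N N (F t) = 0.
Proof.
move=> tT; have [_ _ dF] := sF.
have [_ <-] := is_derive_linear_mx (mulmx Z) (dF t tT).
have : is_derive t (1 : R) (mulmx Z \o F) (0 : 'M[R]_n).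
  apply: (near_eq_is_derive _ (is_derive_cst (0 : 'M[R]_n) t (1 : R))).
  have /andP[t0 t1] := tT.
  near=> s; rewrite /= kermx_F//; apply/andP; split; apply: ltW; near: s.
    exact: lt_nbhsr.
  exact: lt_nbhsl.
by case.
Unshelve. all: by end_near. Qed.

(** Multiplying Z L(F) = 0 by Z^T on the right leaves the sum over a of
    Z N_a F (Z N_a)^T, a sum of positive semidefinite matrices, so each of them
    vanishes.  The term Z A F is then all that remains of Z L(F). *)
Lemma kermx_lyap_terms t : 0 < t < T ->
  Z *m A *m F t = 0 /\ forall a, Z *m N a *m F t = 0.
Proof.
move=> tT; have tT' : 0 <= t <= T by case/andP: tT => ? ?; rewrite !ltW.
have ZF := kermx_F tT'; have [Fs _] := covariance_sym_psd tT'.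
have FZ : F t *m Z^T = 0.
  by rewrite -[F t]Fs -trmx_mul ZF trmx0.
have ZL := kermx_lyap_F tT.
have [G FG] := sym_psd_gram (covariance_sym_psd tT').
have NF a : Z *m N a *m F t = 0.
  suff : Z *m N a *m G^T = 0 by move=> E; rewrite FG mulmxA E mul0mx.
  move: a; apply: sum_mul_tr_eq0.
  transitivity (Z *m lyap A A N N (F t) *m Z^T); last by rewrite ZL mul0mx.
  rewrite /lyap !mulmxDr !mulmxDl !mulmxA ZF !mul0mx -[_ *m F t *m _]mulmxA FZ.
  rewrite mulmx0 !add0r mulmx_sumr mulmx_suml; apply: eq_bigr => a _.
  by rewrite FG !trmx_mul trmxK !mulmxA.
split=> //; rewrite -[RHS]ZL /lyap !mulmxDr !mulmxA ZF mul0mx addr0.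
rewrite mulmx_sumr big1 ?addr0// => a _.
by rewrite !mulmxA NF mul0mx.
Qed.

(** The identities Z A F(t) = 0 and Z N_a F(t) = 0, integrated over time. *)
Lemma kermx_invariant : (Z *m A <= Z)%MS /\ forall a, (Z *m N a <= Z)%MS.
Proof.
have cF : {within `[0, T], continuous F} by case: sF.
split=> [|a]; apply/sub_kermxP; apply: mulmx_integral_eq0 => // t tT.
  exact: (kermx_lyap_terms tT).1.
exact: (kermx_lyap_terms tT).2.
Qed.

Hypothesis sX : solves_ode T (lyap A Ar N Nr) (B *m Br^T) X.

(** The product Z X solves a linear equation on the kernel, whose coefficients
    A1 and N1 a are those by which A and N a act there. *)
Lemma kermx_mixed t : 0 <= t <= T -> Z *m X t = 0.
Proof.
have [/submxP[A1 ZA] ZN_] := kermx_invariant.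
have /choice[N1 ZN] : forall a, exists D, Z *m N a = D *m Z.
  by move=> a; exact/submxP.
have fL M : mulmx Z (lyap A Ar N Nr M) = lyap A1 Ar N1 Nr (mulmx Z M).
  exact: lyap_intertwine.
have := solves_ode_linear fL sX.
rewrite /= mulmxA kermx_initial mul0mx => s0.
by apply: (linear_ode_zero s0).
Qed.

Lemma mixed_annihilator d (W : 'M[R]_(d, n)) t :
  W *m P = 0 -> 0 <= t <= T -> W *m X t = 0.
Proof.
by move=> /sub_kermxP/submxP[D ->] tT; rewrite -mulmxA kermx_mixed// mulmx0.
Qed.

End Reachable.

(** * Decomposition along the dominant subspace *)

(** The coefficient is an explicit function of Y; for a time-dependent Y this
    gives the coefficient functions without a choice for each time. *)
Lemma mulmx_pinv_of_annihilator (R : fieldType) n k l (P : 'M[R]_(n, l))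
    (Y : 'M[R]_(n, k)) :
  (forall W : 'M[R]_n, W *m P = 0 -> W *m Y = 0) ->
  Y = P *m (Y^T *m pinvmx P^T)^T.
Proof.
move=> PY; have YP : (Y^T <= P^T)%MS.
  rewrite submxE -[_ *m _]trmxK trmx_mul trmxK PY ?trmx0//.
  by rewrite -[LHS]trmxK trmx_mul trmxK mulmx_coker trmx0.
by rewrite -{1}[Y]trmxK -{1}(mulmxKpV YP) trmx_mul trmxK.
Qed.

Lemma mul_diag_split (R : comRingType) n k l d (U : 'M[R]_(n, k + l))
    (sigma : 'rV[R]_(k + l)) (D : 'M[R]_(k + l, d)) :
  U *m diag_mx sigma *m D =
  lsubmx U *m (diag_mx (lsubmx sigma) *m usubmx D)
  + rsubmx U *m diag_mx (rsubmx sigma) *m dsubmx D.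
Proof.
rewrite -{1}[U]hsubmxK -{1}[sigma]hsubmxK -{1}[D]vsubmxK diag_mx_row.
by rewrite mul_row_block mul_row_col !mulmx0 addr0 add0r mulmxA.
Qed.

(** Its fundamental solution is the Phi_d of the dual covariances. *)
Definition dual_system (R : realType) (q m p n : nat) (s : system R q m p n) :
    system R q p m n :=
  System (sysA s)^T (fun i => (sysN s i)^T) (sysC s)^T (sysX0 s)^T.

Lemma dual_covarianceE (R : realType) (q m p n k : nat) (T : R) (K : 'M[R]_q)
    (s : system R q m p n) (r : system R q m p k) :
  dual_covariance T K s r =
  state_covariance T K (dual_system s) (dual_system r).
Proof.
rewrite /dual_covariance /state_covariance /= trmxK; congr solves_ode.
apply/funext => X; rewrite /mixed_adj /mixed_op /= trmxK; congr (_ + _).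
by apply: eq_bigr => i _; apply: eq_bigr => j _; rewrite trmxK.
Qed.

Lemma covariance_annihilator (R : realType) (q m p n k : nat) (T : R)
    (K : 'M[R]_q) (s : system R q m p n) (r : system R q m p k)
    (F : R -> 'M[R]_n) (X : R -> 'M[R]_(n, k)) d (W : 'M[R]_(d, n)) (t : R) :
  0 < T -> sym_psd K -> state_covariance T K s s F ->
  state_covariance T K s r X ->
  W *m mx_integral T F = 0 -> 0 <= t <= T -> W *m X t = 0.
Proof.
move=> T0 /sym_psd_gram[L ->]; rewrite /state_covariance !mixed_op_lyap.
by move=> sF sX; exact: (mixed_annihilator T0 sF sX).
Qed.

(** Both Ft and the integral of X have their columns in the column space of the
    integral of F.  In a step of the iteration r' is the reduced system after
    the change of basis. *)
Lemma dominant_subspace_decomposition (R : realType) (q m p k l : nat) (T : R)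
    (K : 'M[R]_q) (s : system R q m p (k + l)) (r r' : system R q m p k)
    (V : 'M[R]_(k + l, k)) (F : R -> 'M[R]_(k + l))
    (Ft X : R -> 'M[R]_(k + l, k)) (U : 'M[R]_(k + l)) (sigma : 'rV[R]_(k + l)) :
  0 < T -> sym_psd K -> state_covariance T K s s F ->
  state_covariance T K s r Ft -> state_covariance T K s r' X ->
  orthonormal_im_basis V (mx_integral T X) ->
  mx_integral T F = U *m diag_mx sigma *m U^T ->
  exists (MF : R -> 'M[R]_k) (MF2 : R -> 'M[R]_(l, k))
         (MP : 'M[R]_k) (MP2 : 'M[R]_(l, k)),
    (forall t : R, 0 <= t <= T ->
       Ft t = lsubmx U *m MF t
              + rsubmx U *m diag_mx (rsubmx sigma) *m MF2 t) /\
    V = lsubmx U *m MP + rsubmx U *m diag_mx (rsubmx sigma) *m MP2.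
Proof.
move=> T0 Kpsd sF sFt sX [_ /andP[VX _]] PU.
pose D (Y : 'M[R]_(k + l, k)) := U^T *m (Y^T *m pinvmx (mx_integral T F)^T)^T.
pose M1 Y := diag_mx (lsubmx sigma) *m usubmx (D Y).
pose M2 Y := dsubmx (D Y).
have split_range Y : (forall W : 'M[R]_(k + l), W *m mx_integral T F = 0 -> W *m Y = 0) ->
    Y = lsubmx U *m M1 Y + rsubmx U *m diag_mx (rsubmx sigma) *m M2 Y.
  move=> /mulmx_pinv_of_annihilator {1}->.
  by rewrite /M1 /M2 -mul_diag_split /D [_ *m (U^T *m _)]mulmxA -PU.
exists (M1 \o Ft), (M2 \o Ft), (M1 V), (M2 V); split=> [t tT|].
  apply: split_range => W WP.
  exact: (covariance_annihilator T0 Kpsd sF sFt WP).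
apply: split_range => W WP.
have [E VE] := submxP VX.
rewrite -[V]trmxK VE trmx_mul trmxK mulmxA mulmx_integral_eq0 ?mul0mx//.
  by case: sX.
move=> t /andP[t0 tT].
by rewrite (covariance_annihilator T0 Kpsd sF sX WP)// !ltW.
Qed.
(* The full order is n = k + l, where k is the reduced order. *)
Theorem theorem3p5 (R : realType) (q m p k l : nat) (T : R) (K : 'M[R]_q)
    (full : system R q m p (k + l)) (red_in red : system R q m p k)
    (V W : 'M[R]_(k + l, k))
    (F G : R -> 'M[R]_(k + l)) (Ft Gt : R -> 'M[R]_(k + l, k))
    (TP TQ : 'M[R]_(k + l)) (sigmaP sigmaQ : 'rV[R]_(k + l))
    (T_gt0 : 0 < T)
    (K_psd : sym_psd K)
    (step : sylvester_step T K full red_in red V W)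
    (converged : red = red_in)
    (L_inv : bijective (mixed_op K full full))
    (Lhat_inv : bijective (mixed_op K red red))
    (F_cov : state_covariance T K full full F)
    (Ft_cov : state_covariance T K full red Ft)
    (G_cov : dual_covariance T K full full G)
    (Gt_cov : dual_covariance T K full red Gt)
    (TP_inv : TP \in unitmx)
    (TQ_inv : TQ \in unitmx)
    (P_diag : mx_integral T F = TP *m diag_mx sigmaP *m TP^T)
    (Q_diag : mx_integral T G = TQ *m diag_mx sigmaQ *m TQ^T) :
  let VP := lsubmx TP in
  let TP2 := rsubmx TP in
  let SigmaP2 := diag_mx (rsubmx sigmaP) in
  let WQ := lsubmx TQ in
  let TQ2 := rsubmx TQ in
  let SigmaQ2 := diag_mx (rsubmx sigmaQ) in
  (exists (MF : R -> 'M[R]_k) (MF2 : R -> 'M[R]_(l, k))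
          (MP : 'M[R]_k) (MP2 : 'M[R]_(l, k)),
     (forall t : R, 0 <= t <= T ->
        Ft t = VP *m MF t + TP2 *m SigmaP2 *m MF2 t) /\
     V = VP *m MP + TP2 *m SigmaP2 *m MP2) /\
  (exists (MG : R -> 'M[R]_k) (MG2 : R -> 'M[R]_(l, k))
          (MQ : 'M[R]_k) (MQ2 : 'M[R]_(l, k)),
     (forall t : R, 0 <= t <= T ->
        Gt t = WQ *m MG t + TQ2 *m SigmaQ2 *m MG2 t) /\
     W = WQ *m MQ + TQ2 *m SigmaQ2 *m MQ2).
Proof.
move=> VP TP2 SigmaP2 WQ TQ2 SigmaQ2.
have [S [X [Y [_ [sX sY] [bV bW] _ _]]]] := step.
split; first exact: (dominant_subspace_decomposition T_gt0 K_psd F_cov Ft_cov sX bV P_diag).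
rewrite !dual_covarianceE in G_cov Gt_cov sY.
exact: (dominant_subspace_decomposition T_gt0 K_psd G_cov Gt_cov sY bW Q_diag).
Qed.
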